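(* Let $p$ be an optimization term, let $n$ be its normal form, and let $c$ be any canonical form of $p$. Then $\mathrm{cost}(c)\leq\mathrm{cost}(n)$.
   Context: Names: an enumerable set $\mathcal{N}$. Atomic problems: a set $C$ with arity $ar$, including $nil$ with $ar(nil)=0$. Optimization terms: $p,q::=p\parallel q\mid(x)p\mid p\pi\mid A(\tilde x)\mid nil$ ($\pi$ a permutation of $\mathcal{N}$, $|\tilde x|=ar(A)$), restriction binding tighter than $\parallel$. Free names: $fn(p\parallel q)=fn(p)\cup fn(q)$, $fn((x)p)=fn(p)\setminus\{x\}$, $fn(p\pi)=\pi(fn(p))$, $fn(A(\tilde x))=\tilde x$, $fn(nil)=\emptyset$. Structural congruence $\equiv$ is generated by: commutative monoid laws for $\parallel$ with unit $nil$; $(x)(y)p\equiv(y)(x)p$, $(x)nil\equiv nil$; $\alpha$-conversion $(x)p\equiv(y)p[x\mapsto y]$ for $y\notin fn(p)$; scope extension (AX$_{SE}$) $(x)(p\parallel q)\equiv(x)p\parallel q$ for $x\notin fn(q)$; $p\,\mathsf{id}\equiv p$, $(p\pi')\pi\equiv p(\pi\circ\pi')$; permutations distribute over the constructors, $A(x_1,\dots,x_n)\pi\equiv A(\pi(x_1),\dots,\pi(x_n))$, $nil\,\pi\equiv nil$, acting capture-avoidingly under restrictions. The hierarchical congruence is the one generated by all these axioms except AX$_{SE}$. A term is in normal form if it is $(\tilde x)(A_1(\tilde x_1)\parallel\dots\parallel A_n(\tilde x_n))$ with $A_i\in C$ and $\tilde x\subseteq\tilde x_1\cup\dots\cup\tilde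 x_n$; the normal form of $p$ is the (unique up to hierarchical congruence) normal-form term $\equiv$-congruent to $p$. A canonical form of $p$ is a term obtained from $p$ by repeatedly applying AX$_{SE}$ from left to right (rewriting $(x)(p'\parallel q')$ to $(x)p'\parallel q'$ when $x\notin fn(q')$, working modulo the hierarchical congruence) until no more applications are possible; in both forms subterms $(\tilde x)nil$ are removed. Complexity (defined on terms without permutation operators): $\mathrm{cost}(A(\tilde x))=|\tilde x|$, $\mathrm{cost}(nil)=0$, $\mathrm{cost}((x)p)=\mathrm{cost}(p)$, $\mathrm{cost}(p\parallel q)=\max\{\mathrm{cost}(p),\mathrm{cost}(q),|fn(p\parallel q)|\}$. *)

(* Defs.v *)
From Stdlib Require Import Relation_Operators.
From mathcomp Require Import all_boot finmap.

Set Implicit Arguments.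
Unset Strict Implicit.
Unset Printing Implicit Defensive.

Local Open Scope fset_scope.

(* Arbitrary bijections of the names: no finite-support condition. *)
Record nperm (N : Type) := NPerm { nfun :> N -> N; nfun_bij : bijective nfun }.

Definition idp (N : Type) : nperm N := NPerm (inv_bij ((fun=> erefl) : involutive (@id N))).

Definition compp (N : Type) (pi pi' : nperm N) : nperm N :=
  NPerm (bij_comp (nfun_bij pi) (nfun_bij pi')).

Definition swap (N : eqType) (x y z : N) : N :=
  if z == x then y else if z == y then x else z.

Lemma swapK (N : eqType) (x y : N) : involutive (swap x y).
Proof.
move=> z; rewrite /swap; have [->|zx] := eqVneq z x.
  by have [->|] := eqVneq y x; rewrite ?eqxx.
have [->|zy] := eqVneq z y; first by rewrite eqxx.
by rewrite (negbTE zx) (negbTE zy).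
Qed.

Definition swapp (N : eqType) (x y : N) : nperm N := NPerm (inv_bij (@swapK N x y)).

(* The set of atomic problems is C together with a further problem nil of
   arity 0, which has its own constructor; C itself holds the others.
   Arguments of an atom may contain repetitions. *)
Inductive term (N : Type) (C : Type) (ar : C -> nat) : Type :=
| Par of term N ar & term N ar
| Res of N & term N ar
| Perm of term N ar & nperm N
| Atom (A : C) of (ar A).-tuple N
| Nil.

Arguments Nil {N C ar}.
Arguments Atom {N C ar} A _.

Section Terms.
Variables (N : choiceType) (C : Type) (ar : C -> nat).
Local Notation term := (term N ar).
Implicit Types (p q r c n : term) (x y : N) (pi : nperm N).

Fixpoint fn p : {fset N} :=
  match p with
  | Par p q => fn p `|` fn q
  | Res x p => fn p `\ x
  | Perm p pi => [fset pi x | x in fn p]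
  | Atom _ xs => [fset x in tval xs]
  | Nil => fset0
  end.

(* The renaming [x |-> y] in h_alpha is the transposition of x and y: for y not
   free in p it agrees with capture-avoiding substitution.  Under a restriction
   a permutation also acts on the binder, hence never captures. *)
Inductive hax : term -> term -> Prop :=
| h_parA p q r : hax (Par (Par p q) r) (Par p (Par q r))
| h_parC p q : hax (Par p q) (Par q p)
| h_par0 p : hax (Par p Nil) p
| h_resC x y p : hax (Res x (Res y p)) (Res y (Res x p))
| h_res0 x : hax (Res x Nil) Nil
| h_alpha x y p : y \notin fn p -> hax (Res x p) (Res y (Perm p (swapp x y)))
| h_perm1 p : hax (Perm p (idp N)) p
| h_permM p pi pi' : hax (Perm (Perm p pi') pi) (Perm p (compp pi pi'))
| h_perm_par p q pi : hax (Perm (Par p q) pi) (Par (Perm p pi) (Perm q pi))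
| h_perm_res x p pi : hax (Perm (Res x p) pi) (Res (pi x) (Perm p pi))
| h_perm_atom A (xs : (ar A).-tuple N) pi :
    hax (Perm (Atom A xs) pi) (Atom A [tuple of map pi xs])
| h_perm_nil pi : hax (Perm Nil pi) Nil.

Inductive se : term -> term -> Prop :=
| se_ax x p q : x \notin fn q -> se (Res x (Par p q)) (Par (Res x p) q).

Inductive congruence (R : term -> term -> Prop) : term -> term -> Prop :=
| c_ax p q : R p q -> congruence R p q
| c_refl p : congruence R p p
| c_sym p q : congruence R p q -> congruence R q p
| c_trans p q r : congruence R p q -> congruence R q r -> congruence R p r
| c_par p p' q q' : congruence R p p' -> congruence R q q' ->
    congruence R (Par p q) (Par p' q')
| c_res x p p' : congruence R p p' -> congruence R (Res x p) (Res x p')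
| c_perm p p' pi : congruence R p p' -> congruence R (Perm p pi) (Perm p' pi).

Definition hcong : term -> term -> Prop := congruence hax.

Definition scong : term -> term -> Prop :=
  congruence (fun p q => hax p q \/ se p q).

(* One left-to-right use of scope extension at an arbitrary position. *)
Inductive se_step : term -> term -> Prop :=
| s_ax p q : se p q -> se_step p q
| s_parl p p' q : se_step p p' -> se_step (Par p q) (Par p' q)
| s_parr p q q' : se_step q q' -> se_step (Par p q) (Par p q')
| s_res x p p' : se_step p p' -> se_step (Res x p) (Res x p')
| s_perm p p' pi : se_step p p' -> se_step (Perm p pi) (Perm p' pi).

(* Trivial uses such as (x)(p || nil) -> (x)p || nil are available for every
   restriction modulo hcong; they stay in the same hcong class and do not
   count as reductions. *)
Definition se_irreducible c : Prop :=
  forall p q, hcong c p -> se_step p q -> hcong p q.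

Fixpoint nil_free p : bool :=
  match p with
  | Par p q => nil_free p && nil_free q
  | Res _ p => nil_free p
  | Perm p _ => nil_free p
  | Atom _ _ => true
  | Nil => false
  end.

Definition canonical_form p c : Prop :=
  [/\ clos_refl_trans term (fun q r => hcong q r \/ se_step q r) p c,
      se_irreducible c
    & c = Nil \/ nil_free c].

(* Nonempty parallel compositions of atoms, bracketed in any way. *)
Fixpoint atoms p : bool :=
  match p with
  | Par p q => atoms p && atoms q
  | Atom _ _ => true
  | _ => false
  end.

(* The disjunct b = Nil is the empty parallel composition; fn b is the union
   of the arguments of the atoms. *)
Definition is_normal n : Prop :=
  exists (xs : seq N) (b : term),
    [/\ n = foldr (@Res N C ar) b xs, b = Nil \/ atoms b, uniq xs
      & {subset xs <= fn b}].

Definition normal_form p n : Prop := is_normal n /\ scong p n.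

Fixpoint perm_free p : bool :=
  match p with
  | Par p q => perm_free p && perm_free q
  | Res _ p => perm_free p
  | Perm _ _ => false
  | Atom _ _ | Nil => true
  end.

(* Meant for perm_free terms only; the value on Perm is a convention. *)
Fixpoint cost p : nat :=
  match p with
  | Par p1 p2 => maxn (maxn (cost p1) (cost p2)) #|` fn (Par p1 p2)|
  | Res _ p => cost p
  | Perm p _ => cost p
  | Atom _ xs => size xs
  | Nil => 0
  end.

End Terms.

(* Main.v *)
From mathcomp Require Import all_boot finmap zify.
Require Import Defs.

(** Scope extension is immaterial for the bound: every term congruent to [n]
    costs at most [cost n].  Call a restriction [(x)p] effective when [x] is
    free in [p].  The free names, the number of effective restrictions and the
    largest arity of an atom are all invariant under structural congruence.  The
    names free in any subterm are free in the whole term or bound by distinct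
    effective restrictions, so the cost is at most the maximum of the largest
    arity and of (free names + effective restrictions); a normal form attains
    this maximum, all its names being free in its parallel composition. *)

Set Implicit Arguments.
Unset Strict Implicit.
Unset Printing Implicit Defensive.

Local Open Scope fset_scope.

Section Cost.
Variables (N : choiceType) (C : Type) (ar : C -> nat).
Local Notation term := (term N ar).
Implicit Types (p q r : term) (x y : N) (pi : nperm N).

(** Vacuous restrictions must count for nothing: [h_res0] erases one. *)
Fixpoint effective_res p : nat :=
  match p with
  | Par p q => effective_res p + effective_res q
  | Res x p => (x \in fn p) + effective_res p
  | Perm p _ => effective_res p
  | Atom _ _ | Nil => 0
  end.

Fixpoint max_arity p : nat :=
  match p with
  | Par p q => maxn (max_arity p) (max_arity q)
  | Res _ p => max_arity p
  | Perm p _ => max_arity p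
  | Atom A _ => ar A
  | Nil => 0
  end.

Definition name_count p : nat := #|` fn p| + effective_res p.

Lemma mem_fn_perm p pi x : (pi x \in fn (Perm p pi)) = (x \in fn p).
Proof. by rewrite /= mem_imfset //; apply/bij_inj/nfun_bij. Qed.

Lemma mem_fn_swap p x y z :
  (z \in fn (Perm p (swapp x y))) = (swap x y z \in fn p).
Proof. by rewrite -{1}(swapK x y z) -[swap x y _]/(swapp x y _) mem_fn_perm. Qed.

(** As [pi] is surjective, membership need only be compared at names of the form [pi x], where no
    image set has to be unfolded. *)
Lemma eq_fn_perm p q pi :
  (forall x, (pi x \in fn q) = (x \in fn p)) -> fn (Perm p pi) = fn q.
Proof.
move=> eq_pi; have [g _ piK] := nfun_bij pi; apply/fsetP=> x.
by rewrite -(piK x) mem_fn_perm eq_pi.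
Qed.

Lemma fn_hax p q : hax p q -> fn p = fn q.
Proof.
case=> {p q} //=.
- by move=> p q r; rewrite fsetUA.
- by move=> p q; rewrite fsetUC.
- by move=> p; rewrite fsetU0.
- by move=> x y p; apply/fsetP=> z; rewrite !inE andbCA.
- by move=> x; rewrite fset0D.
- move=> x y p yNp; apply/fsetP=> z.
  rewrite -[[fset _ | _ in _]]/(fn (Perm p (swapp x y))) !in_fsetD1 mem_fn_swap.
  (* The swap moves only [x] and [y]. Each is excluded on one side by the binder and on the other
     because [y] is not free in [p]. *)
  rewrite /swap; case: (eqVneq z x) => [->|_]; last first.
    by case: eqVneq => [->|//]; rewrite (negbTE yNp).
  by rewrite (negbTE yNp) andbF.
- by move=> p; apply: (@eq_fn_perm p p (idp N)).
- move=> p pi pi'; apply/esym.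
  apply: (@eq_fn_perm p (Perm (Perm p pi') pi) (compp pi pi')) => x.
  by rewrite -[compp pi pi' x]/(pi (pi' x)) !mem_fn_perm.
- by move=> p q pi; rewrite imfsetU.
- move=> x p pi; apply: (@eq_fn_perm (Res x p) (Res (pi x) (Perm p pi))) => z.
  rewrite !in_fsetD1 mem_fn_perm inj_eq //; exact/bij_inj/nfun_bij.
- move=> A xs pi; apply: (@eq_fn_perm (Atom A xs) (Atom A [tuple of map pi xs])).
  by move=> x; rewrite !inE mem_map //; apply/bij_inj/nfun_bij.
- by move=> pi; rewrite imfset0.
Qed.

Lemma effective_res_hax p q : hax p q -> effective_res p = effective_res q.
Proof.
case=> {p q} //=; try by move=> *; lia.
- move=> x y p; rewrite !in_fsetD1.
  (* For [x = y] the two sides coincide; otherwise neither binder affects whether the other is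
     effective. *)
  by case: (eqVneq x y) => [->|_] //=; lia.
- move=> x y p _; rewrite -[[fset _ | _ in _]]/(fn (Perm p (swapp x y))).
  by rewrite mem_fn_swap -{1}(swapK x y x) /swap !eqxx; case: eqVneq => [->|].
- by move=> x p pi; rewrite -[[fset _ | _ in _]]/(fn (Perm p pi)) mem_fn_perm.
Qed.

Lemma max_arity_hax p q : hax p q -> max_arity p = max_arity q.
Proof. by case=> {p q} //= *; lia. Qed.

Lemma scong_invariants p q : scong p q ->
  [/\ fn p = fn q, effective_res p = effective_res q & max_arity p = max_arity q].
Proof.
elim=> {p q} //=.
- move=> p q [pq|[x {}p {}q xNq]].
    by split; [apply: fn_hax | apply: effective_res_hax | apply: max_arity_hax].
  (* Scope extension: since [x] is not free in [q], the restriction is effective on [Par p q]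
     exactly when it is on [p]. *)
  split=> //=; last by rewrite inE (negbTE xNq) orbF addnA.
  by rewrite fsetDUl (mem_fsetD1 xNq).
- by move=> p q _ [-> -> ->].
- by move=> p q r _ [-> -> ->].
- by move=> p p' q q' _ [-> -> ->] _ [-> -> ->].
- by move=> x p p' _ [-> -> ->].
- by move=> p p' pi _ [-> -> ->].
Qed.

(** An effective restriction trades one free name for one unit of [effective_res]; a vacuous one
    changes neither. *)
Lemma name_count_res x p : name_count (Res x p) = name_count p.
Proof. by rewrite /name_count /= [#|` fn p|](cardfsD1 x) addnCA addnA. Qed.

(** Induction: both summands of [name_count] can only grow from a component to a parallel
    composition, and the new term of the cost, the number of free names, is one of these
    summands. *)
Lemma cost_le p : cost p <= maxn (max_arity p) (name_count p).
Proof.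
elim: p => [p IHp q IHq|x p IHp|p IHp pi|A xs|] //=.
- have fnp : #|` fn p| <= #|` fn p `|` fn q| by apply/fsubset_leq_card/fsubsetUl.
  have fnq : #|` fn q| <= #|` fn p `|` fn q| by apply/fsubset_leq_card/fsubsetUr.
  by move: IHp IHq; rewrite /name_count /=; lia.
- by rewrite name_count_res.
- by rewrite /name_count /= card_imfset //; apply/bij_inj/nfun_bij.
- by rewrite size_tuple leq_maxl.
Qed.

Lemma atoms_cost_ge p : atoms p -> maxn (max_arity p) (name_count p) <= cost p.
Proof.
suff ge_cost : atoms p ->
  [/\ max_arity p <= cost p, #|` fn p| <= cost p & effective_res p = 0].
  by move=> /ge_cost [? ? ep]; rewrite /name_count ep addn0 geq_max; apply/andP.
elim: p => [p IHp q IHq|||A xs|] //=.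
  by case/andP=> /IHp [? ? ->] /IHq [? ? ->]; split=> //; lia.
move=> _; rewrite size_tuple; split=> //.
(* Arguments may repeat, so the arity only bounds the number of free names. *)
by rewrite -{3}(size_tuple xs) card_fseq size_undup.
Qed.

(** The restriction prefix changes neither side, which leaves the composition of atoms or [Nil]. *)
Lemma normal_cost_ge p :
  is_normal p -> maxn (max_arity p) (name_count p) <= cost p.
Proof.
case=> xs [b [-> b_atoms _ _]].
elim: xs => [|x xs IHxs] /=; last by rewrite name_count_res.
by case: b_atoms => [->|]; [rewrite /name_count | exact: atoms_cost_ge].
Qed.

Lemma scong_cost_le p q : scong p q -> is_normal q -> cost p <= cost q.
Proof.
move=> /scong_invariants [fn_pq res_pq ar_pq] /normal_cost_ge.
apply: leq_trans; rewrite -ar_pq /name_count -fn_pq -res_pq; exact: cost_le.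
Qed.

Lemma congruence_sub (R S : term -> term -> Prop) p q :
  (forall p q, R p q -> S p q) -> congruence R p q -> congruence S p q.
Proof.
move=> RS; elim=> {p q} *.
- by apply/c_ax/RS.
- exact: c_refl.
- exact: c_sym.
- by apply: c_trans; eassumption.
- exact: c_par.
- exact: c_res.
- exact: c_perm.
Qed.

Lemma se_step_scong p q : se_step p q -> scong p q.
Proof.
elim=> {p q} *.
- by apply: c_ax; right.
- by apply: c_par => //; apply: c_refl.
- by apply: c_par => //; apply: c_refl.
- exact: c_res.
- exact: c_perm.
Qed.

Lemma canonical_form_scong p q : canonical_form p q -> scong p q.
Proof.
case=> + _ _; elim=> {p q} [p q [pq|]|p|p q r _ pq _ qr].
- by apply: congruence_sub pq => {}p {}q; left.
- exact: se_step_scong.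
- exact: c_refl.
- exact: c_trans pq qr.
Qed.

End Cost.

Theorem theorem2 (N : countType) (C : Type) (ar : C -> nat) (p n c : term N ar)
    (hn : normal_form p n) (hc : canonical_form p c) (hcp : perm_free c) :
  cost c <= cost n.
Proof.
case: hn => n_normal p_n; apply: scong_cost_le n_normal.
exact: c_trans (c_sym (canonical_form_scong hc)) p_n.
Qed.
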